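(* Let $X$ be a Banach space and let $T$ be a bounded linear operator on $X$. Assume that there exists a sequence $(y_n)_{n\ge1}$ in $X$ such that (1) $\displaystyle\sup_{\varepsilon_k=\pm1}\Big\|\sum_{k=n}^{2n}\varepsilon_ky_k\Big\|\longrightarrow0$ as $n\to\infty$, where for each $n$ the supremum is over all choices of signs $\varepsilon_n,\dots,\varepsilon_{2n}\in\{-1,1\}$; (2) there exists $n_0\ge1$ such that $\inf_{n\ge n_0}\|T^ny_n\|>0$. Then $T$ is not absolutely Cesàro bounded.
   Context: A bounded linear operator $T$ on a Banach space $X$ is absolutely Cesàro bounded if there is $C>0$ with $\sup_{n\ge1}\frac1n\sum_{k=0}^{n-1}\|T^kx\|\le C\|x\|$ for all $x\in X$. *)

(* Defs.v *)
From HB Require Import structures.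
From mathcomp Require Import all_boot all_order all_algebra.
From mathcomp Require Import all_classical all_reals all_analysis.
From mathcomp Require Import complex.

Set Implicit Arguments.
Unset Strict Implicit.
Unset Printing Implicit Defensive.

Import Order.TTheory GRing.Theory Num.Theory.
Import numFieldNormedType.Exports.

Local Open Scope classical_set_scope.
Local Open Scope ring_scope.

(* The scalar field of a Banach space is R or C. *)
Inductive scalar_kind := RealScalars | ComplexScalars.

Definition scalars (R : realType) (s : scalar_kind) : numFieldType :=
  match s with
  | RealScalars => R
  | ComplexScalars => R[i]
  end.

Definition real_part (R : realType) (s : scalar_kind) : scalars R s -> R :=
  match s return scalars R s -> R with
  | RealScalars => fun a => a
  | ComplexScalars => fun a => complex.Re a
  end.

(* The norm of a [normedModType K] takes its values in [K]; for [K = R[i]] these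
   values are nonnegative, hence of the form [r +i* 0], and [real_part]
   extracts [r]. *)
Definition rnorm (R : realType) (s : scalar_kind)
    (X : normedModType (scalars R s)) (x : X) : R :=
  real_part `|x|.

Definition bounded_operator (R : realType) (s : scalar_kind)
    (X : normedModType (scalars R s)) (T : {linear X -> X}) : Prop :=
  exists M : R, forall x : X, rnorm (T x) <= M * rnorm x.

(* The supremum is taken in the extended reals, where it is always defined. *)
Definition absolutely_Cesaro_bounded (R : realType) (s : scalar_kind)
    (X : normedModType (scalars R s)) (T : {linear X -> X}) : Prop :=
  exists2 C : R, 0 < C &
    forall x : X,
      (ereal_sup [set (n%:R^-1 * \sum_(0 <= k < n) rnorm (iter k T x))%:E
                  | n in [set n : nat | (1 <= n)%N]]
       <= (C * rnorm x)%:E)%E.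

(* Only the signs [e k] with [n <= k <= 2 n] matter, so the set is finite and
   nonempty and [sup] is its maximum. *)
Definition sup_signed_sum (R : realType) (s : scalar_kind)
    (X : normedModType (scalars R s)) (y : nat -> X) (n : nat) : R :=
  sup [set rnorm (\sum_(n <= k < (2 * n).+1) e k *: y k)
      | e in [set e : nat -> scalars R s | forall k, e k = 1 \/ e k = - 1]].

(* Main.v *)
(* If T were absolutely Cesaro bounded, apply the estimate up to time 2n + 1 to
   x_e = \sum_(n <= k <= 2n) e_k y_k and average over the signs e.  Since the
   average of |T^j x_e| is at least |T^j y_j| for n <= j <= 2n, this gives
   (n + 1) delta <= C (2n + 1) sup_e |x_e|, where delta = inf |T^j y_j|;
   as sup_e |x_e| tends to 0, delta <= 0. *)

Require Import Defs.
From HB Require Import structures.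
From mathcomp Require Import all_boot all_order all_algebra.
From mathcomp Require Import all_classical all_reals all_analysis.
From mathcomp Require Import complex zify.

Set Implicit Arguments.
Unset Strict Implicit.
Unset Printing Implicit Defensive.

Import Order.TTheory GRing.Theory Num.Theory.
Import numFieldNormedType.Exports.

Local Open Scope classical_set_scope.
Local Open Scope ring_scope.

Section RealNorm.
Variables (R : realType) (s : scalar_kind) (X : normedModType (scalars R s)).
Implicit Types x y : X.

Lemma real_partD (a b : scalars R s) :
  real_part (a + b) = real_part a + real_part b.
Proof. by case: s a b => //= a b; rewrite raddfD. Qed.

Lemma ler_real_part (a b : scalars R s) :
  a <= b -> real_part a <= real_part b.
Proof. by case: s a b => //= a b; rewrite lecE => /andP[]. Qed.

Lemma rnorm_ge0 x : 0 <= rnorm x.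
Proof.
have -> : 0 = real_part (0 : scalars R s) by case: (s).
exact/ler_real_part/normr_ge0.
Qed.

Lemma rnormD x y : rnorm (x + y) <= rnorm x + rnorm y.
Proof. by rewrite /rnorm -real_partD; exact/ler_real_part/ler_normD. Qed.

Lemma rnormN x : rnorm (- x) = rnorm x.
Proof. by rewrite /rnorm normrN. Qed.

Lemma rnorm0 : rnorm (0 : X) = 0.
Proof. by rewrite /rnorm normr0; case: (s). Qed.

Lemma rnormMn2 x : rnorm (x *+ 2) = rnorm x *+ 2.
Proof. by rewrite /rnorm normrMn [_ *+ 2]mulr2n real_partD. Qed.

Lemma rnorm_sum (I : Type) (r : seq I) (P : pred I) (F : I -> X) :
  rnorm (\sum_(i <- r | P i) F i) <= \sum_(i <- r | P i) rnorm (F i).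
Proof.
elim/big_rec2: _ => [|i b a _ le_ab]; first by rewrite rnorm0.
by rewrite (le_trans (rnormD _ _))// lerD2l.
Qed.

Lemma rnorm_sign (b : bool) x : rnorm ((-1) ^+ b *: x) = rnorm x.
Proof. by case: b; rewrite ?expr0 ?scale1r// expr1 scaleN1r rnormN. Qed.

(** Signs are coded by Booleans on a finite type, so that the average over all choices is a finite
    sum; choices that differ only off [P] are counted separately. *)
Definition signed_sum (I : finType) (P : pred I) (y : I -> X)
    (e : {ffun I -> bool}) : X :=
  \sum_(i | P i) (-1) ^+ e i *: y i.

(* Pairing e with the signs opposite to e away from j, the two signed sums add
   up to [2 e_j y_j]. *)
Lemma sum_rnorm_signed_sum (I : finType) (P : pred I) (y : I -> X)
    (f : {additive X -> X}) (j : I) : P j ->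
  \sum_(e : {ffun I -> bool}) rnorm (f (y j)) <=
  \sum_(e : {ffun I -> bool}) rnorm (f (signed_sum P y e)).
Proof.
move=> Pj; pose flip (e : {ffun I -> bool}) := [ffun i => (i != j) (+) e i].
have flipK : involutive flip.
  by move=> e; apply/ffunP => i; rewrite !ffunE addbA addbb.
have pairE e : signed_sum P y e + signed_sum P y (flip e)
    = ((-1) ^+ e j *: y j) *+ 2.
  rewrite /signed_sum -big_split/= (bigD1 j)//= big1 ?addr0.
    by rewrite ffunE eqxx /= mulr2n.
  move=> i /andP[_ neq_ij]; rewrite ffunE neq_ij /= -scalerDl.
  by case: (e i); rewrite /= ?expr0 ?expr1 ?addNr ?addrN scale0r.
(* After doubling, one of the two copies of the right-hand sum is reindexed by [flip], so that the
   pairing applies term by term. *)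
rewrite -(@ler_pMn2r _ 2)// [leRHS]mulr2n.
rewrite [X in _ + X](reindex_inj (inv_inj flipK)) -big_split -sumrMnl /=.
apply: ler_sum => e _; rewrite (le_trans _ (rnormD _ _))// -raddfD pairE.
rewrite raddfMn rnormMn2 ler_pMn2r//.
(* [f] is only additive, so the remaining sign is taken out as a negation. *)
by case: (e j); rewrite ?expr0 ?scale1r// expr1 scaleN1r raddfN rnormN.
Qed.

Lemma le_sup_signed_sum (y : nat -> X) (n : nat)
    (e : {ffun 'I_(2 * n).+1 -> bool}) :
  rnorm (signed_sum (fun i : 'I__ => n <= i)%N (fun i => y i) e)
    <= sup_signed_sum y n.
Proof.
apply: ub_le_sup; last first.
  (* Beyond [2 * n] the value of [inord k] is a default, but such [k] do not enter the sum. *)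
  exists (fun k => (-1) ^+ e (inord k)) => [k|].
    by case: (e _); [right; rewrite expr1|left; rewrite expr0].
  by rewrite big_geq_mkord; congr rnorm; apply: eq_bigr => i _; rewrite inord_val.
(* The triangle inequality bounds the set above, as a real [sup] requires. *)
exists (\sum_(n <= k < (2 * n).+1) rnorm (y k)) => _ [d d1 <-].
apply: le_trans (rnorm_sum _ _ _) _; apply: ler_sum => k _.
by case: (d1 k) => ->; rewrite ?scale1r// scaleN1r rnormN.
Qed.

Lemma absolutely_Cesaro_bounded_sum (T : {linear X -> X}) :
  absolutely_Cesaro_bounded T ->
  exists2 C : R, 0 < C & forall x n,
    \sum_(k < n.+1) rnorm (iter k T x) <= n.+1%:R * (C * rnorm x).
Proof.
case=> C C0 TC; exists C => // x n; rewrite -ler_pdivrMl// -lee_fin.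
apply: le_trans (TC x); apply: ereal_sup_ubound.
by exists n.+1 => //; rewrite big_mkord.
Qed.

(** This puts the iterates in the form that [sum_rnorm_signed_sum] accepts. *)
Lemma iter_is_additive (T : {linear X -> X}) (n : nat) :
  exists f : {additive X -> X}, f =1 iter n T.
Proof.
elim: n => [|n [f fE]]; first by exists idfun.
by exists (T \o f) => x /=; rewrite fE.
Qed.

Lemma absolutely_Cesaro_bounded_signed_sum (T : {linear X -> X}) :
  absolutely_Cesaro_bounded T ->
  exists2 C : R, 0 < C & forall (y : nat -> X) (d : R) (n : nat),
    (forall k, (n <= k)%N -> d <= rnorm (iter k T (y k))) ->
    d <= C * sup_signed_sum y n.
Proof.
move=> /absolutely_Cesaro_bounded_sum[C C0 TC].
(* The orbit up to time [2 * n] has [2 * n + 1] terms, of which the [n + 1] with index at least [n]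
   are used; the ratio is at most 2. *)
exists (2 * C); first by rewrite mulr_gt0.
move=> y d n dT; pose S := sup_signed_sum y n; pose N := (2 * n).+1.
pose x := signed_sum (fun i : 'I_N => n <= i)%N (fun i => y i).
(* [M] counts the sign choices; sums over them replace averages until [M] is cancelled. *)
pose M : R := #|{ffun 'I_N -> bool}|%:R.
have M0 : 0 < M.
  by rewrite ltr0n card_ffun card_bool expn_gt0.
have lower : d *+ n.+1 * M <=
    \sum_(i < N | (n <= i)%N) \sum_e rnorm (iter i T (x e)).
  have -> : d *+ n.+1 * M = \sum_(i < N | (n <= i)%N) d * M.
    rewrite -(big_geq_mkord _ _ xpredT (fun=> d * M)) sumr_const_nat mulrnAl.
    by congr (_ *+ _); rewrite /N; lia.
  apply: ler_sum => i ni; have [f fE] := iter_is_additive T i.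
  under eq_bigr do rewrite -fE.
  apply: le_trans (sum_rnorm_signed_sum (fun i : 'I_N => y i) f ni).
  by rewrite sumr_const fE -mulr_natr ler_wpM2r ?dT// ler0n.
have upper : \sum_(i < N | (n <= i)%N) \sum_e rnorm (iter i T (x e))
    <= N%:R * (C * S) * M.
  rewrite exchange_big /=.
  have -> : N%:R * (C * S) * M = \sum_(e : {ffun 'I_N -> bool}) N%:R * (C * S).
    by rewrite sumr_const -[RHS]mulr_natr.
  apply: ler_sum => e _; apply: (@le_trans _ _ (N%:R * (C * rnorm (x e)))).
    (* The terms with [i < n] are nonnegative, so adding them completes the Cesàro sum. *)
    apply: le_trans (TC _ _); rewrite [leRHS](bigID (fun i : 'I_N => n <= i)%N)/=.
    by rewrite lerDl sumr_ge0// => i _; exact: rnorm_ge0.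
  by rewrite ler_wpM2l// ler_wpM2l ?(ltW C0)//; exact: le_sup_signed_sum.
have := le_trans lower upper; rewrite ler_pM2r// => le_dS.
(* Nonnegativity is what allows [2 * n + 1] to be enlarged to [2 * (n + 1)] in front of [C * S]. *)
have S0 : 0 <= C * S.
  rewrite mulr_ge0 ?(ltW C0)//.
  exact: le_trans (rnorm_ge0 _) (le_sup_signed_sum y [ffun=> false]).
rewrite -(@ler_pMn2r _ n.+1)// (le_trans le_dS)// -mulrA -mulrnAl -mulrnA.
by rewrite ler_wpM2r// ler_nat /N; lia.
Qed.

End RealNorm.

Theorem theorem4p1 (R : realType) (s : scalar_kind)
    (X : completeNormedModType (scalars R s)) (T : {linear X -> X})
    (Tbounded : bounded_operator T)
    (Hy : exists y : nat -> X,
      sup_signed_sum y n @[n --> \oo] --> (0 : R) /\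
      exists2 n0 : nat, (1 <= n0)%N &
        0 < inf [set rnorm (iter n T (y n)) | n in [set n : nat | (n0 <= n)%N]]) :
  ~ absolutely_Cesaro_bounded T.
Proof.
move=> /absolutely_Cesaro_bounded_signed_sum[C C0 TC].
case: Hy => y [yS [n0 _]]; set A := (X in inf X) => A0.
have d_le n k : (n0 <= n)%N -> (n <= k)%N -> inf A <= rnorm (iter k T (y k)).
  move=> n0n nk; apply: ge_inf; last by exists k => //=; exact: leq_trans nk.
  by exists 0 => _ [m _ <-]; exact: rnorm_ge0.
have CS : C * sup_signed_sum y n @[n --> \oo] --> (0 : R).
  by rewrite -(mulr0 C); apply: cvgM yS; exact: cvg_cst.
(* For [n >= n0] the constant [inf A] lies below [C * sup_signed_sum y n], hence below its limit
   0. *)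
have : inf A <= 0.
  apply: (cvgr_to_ge CS).
  by exists n0 => // n /= n0n; apply: TC => k; exact: d_le.
by rewrite leNgt A0.
Qed.
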